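(* Let $(A,\mathbf{B},\delta)$ be the $C$-algebra arising from an Allen matrix, with standard basis $\mathbf{B}=\{b_0,b_1,\dots,b_{r-1}\}$, and write $k_i=\delta(b_i)$ for $0\le i\le r-1$ (so $k_0=1$). (a) If for some $j$ the degree $k_j\neq 1$ is the smallest among the degrees different from $1$ and divides every degree $k_l\neq 1$, then the number of indices $i\in\{0,\dots,r-1\}$ with $k_i=1$ is a multiple of $k_j$. (b) More generally, let $k_t$ be a degree which is divisible by all the smaller degrees and divides all the bigger degrees. Let $k_s$ be the largest degree among all the degrees strictly less than $k_t$. Let the sum of all the degrees (counted over indices $0\le i\le r-1$) that are strictly less than $k_s$ be $\beta_1k_s$, and let the number of indices $i$ with $k_i=k_s$ be $\beta_2$. Then $\beta_1k_s+\beta_2k_s$ is divisible by $k_t$. (Here $\beta_1k_s\neq 0$ only if $k_s>1$.)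
   Context: Fourier and Allen matrices: rows and columns of $r\times r$ matrices are indexed by $0,1,\dots,r-1$. A Fourier matrix of rank $r$ is a complex $r\times r$ matrix $S$ that is unitary and symmetric, has $S_{i0}>0$ for all $i$, and satisfies $N_{ijk}=\sum_l S_{li}S_{lj}\overline{S_{lk}}\,S_{l0}^{-1}\in\mathbb{Z}$ for all $i,j,k$. The associated Allen matrix is $s=[s_{ij}]$ with $s_{ij}=S_{ij}/S_{i0}$. $C$-algebra arising from $s$: put $P=[p_{ij}]$ with $p_{ij}=s_{ij}s_{0j}$, let $b_j\in\mathbb{C}^r$ be the $j$-th column of $P$, $\mathbf{B}=\{b_0,\dots,b_{r-1}\}$, and let $A$ be the $\mathbb{C}$-span of $\mathbf{B}$ with componentwise multiplication, whose identity is $b_0$. The involution on $A$ is entrywise complex conjugation, and it maps $\mathbf{B}$ to itself. The degree map $\delta:A\to\mathbb{C}$ is the algebra homomorphism giving the $0$-th coordinate, so $\delta(b_j)=p_{0j}=s_{0j}^2>0$. The triple $(A,\mathbf{B},\delta)$ is the $C$-algebra arising from the Allen matrix $s$; $\mathbf{B}$ is its standard basis, $r$ its rank, and the numbers $\delta(b_i)$ its degrees. It is a known fact that these degrees are positive rational integers. *)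

(* Defs.v *)
(* The complex numbers are R[i] for R : realType. *)
From HB Require Import structures.
From mathcomp Require Import all_boot all_order all_algebra.
From mathcomp Require Import spectral complex reals.

Set Implicit Arguments.
Unset Strict Implicit.
Unset Printing Implicit Defensive.

Import Order.TTheory GRing.Theory Num.Theory.
Local Open Scope ring_scope.

(* Matrices of rank r >= 1 are indexed by 'I_n.+1 with r = n.+1, so that the
   distinguished index 0 is ord0. *)

(* Being a rational integer, as a property of a complex number. *)
Definition is_int (R : realType) (x : R[i]) : Prop :=
  exists m : int, x = m%:~R.

(* Divisibility in Z, as a relation between complex numbers; in particular it
   only ever relates rational integers. *)
Definition int_dvd (R : realType) (x y : R[i]) : Prop :=
  exists a b : int, [/\ x = a%:~R, y = b%:~R & (a %| b)%Z].

Definition fusion_coef (R : realType) (n : nat) (S : 'M[R[i]]_n.+1)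
    (i j k : 'I_n.+1) : R[i] :=
  \sum_l S l i * S l j * (S l k)^* / S l ord0.

(* In R[i], 0 < z means that z is real and positive. *)
Record fourier_matrix (R : realType) (n : nat) (S : 'M[R[i]]_n.+1) : Prop :=
  FourierMatrix {
    fourier_unitary : S \is unitarymx;
    fourier_sym : S^T = S;
    fourier_pos : forall i, 0 < S i ord0;
    fourier_int : forall i j k, is_int (fusion_coef S i j k)
  }.

Definition allen_of (R : realType) (n : nat) (S : 'M[R[i]]_n.+1) :
    'M[R[i]]_n.+1 :=
  \matrix_(i, j) (S i j / S i ord0).

Definition allen_matrix (R : realType) (n : nat) (s : 'M[R[i]]_n.+1) : Prop :=
  exists2 S, fourier_matrix S & s = allen_of S.

Definition Pmx (R : realType) (n : nat) (s : 'M[R[i]]_n.+1) : 'M[R[i]]_n.+1 :=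
  \matrix_(i, j) (s i j * s ord0 j).

(* The underlying space of A, a subspace of the algebra C^r with componentwise
   operations. *)
Definition calg (R : realType) (n : nat) (s : 'M[R[i]]_n.+1) :
    {vspace 'cV[R[i]]_n.+1} :=
  <<[seq col j (Pmx s) | j : 'I_n.+1]>>%VS.

Lemma col_Pmx_calg (R : realType) (n : nat) (s : 'M[R[i]]_n.+1) j :
  col j (Pmx s) \in calg s.
Proof. by apply/memv_span/image_f. Qed.

(* b_j as an element of A: by the lemma above the projection vsproj does not
   change the j-th column of P (see std_basisE). *)
Definition std_basis (R : realType) (n : nat) (s : 'M[R[i]]_n.+1)
    (j : 'I_n.+1) : subvs_of (calg s) :=
  vsproj (calg s) (col j (Pmx s)).

Lemma std_basisE (R : realType) (n : nat) (s : 'M[R[i]]_n.+1) j :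
  vsval (std_basis s j) = col j (Pmx s).
Proof. by rewrite /std_basis vsprojK // col_Pmx_calg. Qed.

Definition delta (R : realType) (n : nat) (s : 'M[R[i]]_n.+1)
    (a : subvs_of (calg s)) : R[i] :=
  vsval a ord0 ord0.

Lemma delta_std_basis (R : realType) (n : nat) (s : 'M[R[i]]_n.+1) j :
  delta (std_basis s j) = s ord0 j ^+ 2.
Proof. by rewrite /delta std_basisE !mxE. Qed.

(* Main.v *)
(* The t-th row of S is an eigenvector of the integral matrix
   sum_(i, j) N_ijk N_ijm for the eigenvalue 1 / S_t0 ^ 2, because it is a
   common eigenvector of the fusion matrices and of their transposes.  As S is
   symmetric and unitary, this eigenvalue is (sum_j k_j) / k_t; when the degrees
   are integers it is rational, hence an integer, so every degree divides the
   sum of all degrees.  Both claims follow by discarding from this sum the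
   degrees that are divisible by k_t. *)
Require Import Defs.
From HB Require Import structures.
From mathcomp Require Import all_boot all_order all_algebra.
From mathcomp Require Import algC algnum spectral.
From mathcomp Require Import complex reals ring.
Import Order.TTheory GRing.Theory Num.Theory.
Local Open Scope ring_scope.

(** A rational algebraic integer is an integer. Since [ratr] is injective, the root is pulled back
    from [F] to [rat] and then pushed into [algC], where algebraic integers are at hand. *)
Lemma monic_ratr_root (F : numFieldType) (p : {poly int}) (q : rat) :
  p \is monic -> root (map_poly intr p) (ratr q : F) -> q \is a Num.int.
Proof.
move=> p_monic; rewrite (_ : map_poly intr p = map_poly ratr (map_poly intr p)).
  rewrite fmorph_root => pq.
  suff: ratr q \is a @Num.int algC.
    case/intrP => m qm; apply/intrP; exists m.
    by move: qm; rewrite -[in RHS](ratr_int algC) => /fmorph_inj.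
  apply: Cint_rat_Aint; first exact: Crat_rat.
  apply: (@root_monic_Aint (map_poly intr p)).
  - rewrite (_ : map_poly intr p = map_poly ratr (map_poly intr p)) ?fmorph_root//.
    by rewrite -map_poly_comp; apply: eq_map_poly => m /=; rewrite ratr_int.
  - exact: monic_map.
  - by apply/polyOverP => i; rewrite coef_map /= intr_int.
by rewrite -map_poly_comp; apply: eq_map_poly => m /=; rewrite ratr_int.
Qed.

Section Integers.
Variable R : realType.
Implicit Types x y z : R[i].

Lemma is_intD x y : is_int x -> is_int y -> is_int (x + y).
Proof. by move=> [a ->] [b ->]; exists (a + b); rewrite intrD. Qed.

Lemma is_intM x y : is_int x -> is_int y -> is_int (x * y).
Proof. by move=> [a ->] [b ->]; exists (a * b); rewrite intrM. Qed.

Lemma is_int_sum (I : finType) (P : pred I) (F : I -> R[i]) :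
  (forall i, P i -> is_int (F i)) -> is_int (\sum_(i | P i) F i).
Proof.
by move=> FZ; apply: big_ind => //; [exists 0 | exact: is_intD].
Qed.

Lemma is_int_conj x : is_int x -> x^* = x.
Proof. by case=> m ->; rewrite rmorph_int. Qed.

Lemma is_int_ge1 x : is_int x -> 0 < x -> 1 <= x.
Proof. by case=> m ->; rewrite ltr0z ler1z. Qed.

Lemma int_dvdP x y : int_dvd x y <-> is_int x /\ exists2 z, is_int z & y = z * x.
Proof.
split=> [[a [b [-> -> /dvdzP[c ->]]]]|[[a ->] [_ [c ->] ->]]].
  by split; [exists a | exists c%:~R; [exists c | rewrite intrM]].
by exists a, (c * a); rewrite intrM dvdz_mull.
Qed.

Lemma int_dvd_refl x : is_int x -> int_dvd x x.
Proof.
by move=> xZ; apply/int_dvdP; split=> //; exists 1; rewrite ?mul1r //; exists 1.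
Qed.

Lemma int_dvd_is_int x y : int_dvd x y -> is_int y.
Proof. by case=> a [b [_ -> _]]; exists b. Qed.

Lemma int_dvdB x y z : int_dvd x y -> int_dvd x z -> int_dvd x (y - z).
Proof.
move=> /int_dvdP[xZ [_ [c ->] ->]] /int_dvdP[_ [_ [d ->] ->]].
apply/int_dvdP; split=> //; exists (c - d)%:~R; first by exists (c - d).
by rewrite intrB mulrBl.
Qed.

Lemma int_dvd_sum (I : finType) (P : pred I) (F : I -> R[i]) x :
  is_int x -> (forall i, P i -> int_dvd x (F i)) ->
  int_dvd x (\sum_(i | P i) F i).
Proof.
move=> xZ xF; apply: big_ind => //.
  by apply/int_dvdP; split=> //; exists 0; rewrite ?mul0r //; exists 0.
move=> y z /int_dvdP[_ [_ [c ->] ->]] /int_dvdP[_ [_ [d ->] ->]].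
apply/int_dvdP; split=> //; exists (c + d)%:~R; first by exists (c + d).
by rewrite intrD mulrDl.
Qed.

(** The characteristic polynomial of an integral matrix is monic with integer coefficients. *)
Lemma is_int_eigenvalue n (A : 'M[R[i]]_n) (q : rat) :
  (forall i j, is_int (A i j)) -> eigenvalue A (ratr q) -> q \is a Num.int.
Proof.
(* The boolean equation lets [xchoose] extract an integer matrix [M] that maps to [A]. *)
move=> AZ; have AZb i j : exists m : int, A i j == m%:~R.
  by have [m ->] := AZ i j; exists m.
pose M := \matrix_(i, j) xchoose (AZb i j).
rewrite eigenvalue_root_char (_ : A = map_mx intr M); last first.
  by apply/matrixP => i j; rewrite !mxE -(eqP (xchooseP (AZb i j))).
by rewrite -map_char_poly; apply/monic_ratr_root/char_poly_monic.
Qed.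

End Integers.

Section Fourier.
Variables (R : realType) (n : nat) (S : 'M[R[i]]_n.+1).
Hypothesis fS : fourier_matrix S.

Local Notation N := (fusion_coef S).

Lemma fourier_orthonormal t l : \sum_k S t k * (S l k)^* = (t == l)%:R.
Proof.
have /unitarymxP/matrixP/(_ t l) := fourier_unitary fS.
by rewrite !mxE => <-; apply: eq_bigr => k _; rewrite !mxE.
Qed.

(** Once the sums over [k] and [l] are exchanged, orthonormality of the rows of [S] leaves only the
    term [l = t]. *)
Lemma fusion_mul_row t i j : \sum_k S t k * N i j k = S t i * S t j / S t ord0.
Proof.
have NE k : S t k * N i j k =
    \sum_l S l i * S l j / S l ord0 * (S t k * (S l k)^*).
  by rewrite mulr_sumr; apply: eq_bigr => l _; ring.
rewrite (eq_bigr _ (fun k _ => NE k)) exchange_big (bigD1 t) //=.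
rewrite -mulr_sumr fourier_orthonormal eqxx mulr1 big1 ?addr0// => l lt.
by rewrite -mulr_sumr fourier_orthonormal eq_sym (negPf lt) mulr0.
Qed.

Lemma fusion_mul_col t i k :
  \sum_j S t j * N i j k = (S t i)^* * S t k / S t ord0.
Proof.
have S0C l : (S l ord0)^* = S l ord0.
  by apply/CrealP/gtr0_real/(fourier_pos fS).
have NE j : S t j * N i j k =
    \sum_l (S l i)^* * S l k / S l ord0 * (S t j * (S l j)^*).
  (* An integer equals its own conjugate; conjugating [N i j k] moves the bar onto [S l j], so that
     orthonormality applies to the sum over [j]. *)
  rewrite -(is_int_conj _ _ (fourier_int fS i j k)) rmorph_sum mulr_sumr.
  apply: eq_bigr => l _; rewrite !(rmorphM, fmorphV) /= conjCK S0C; ring.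
rewrite (eq_bigr _ (fun j _ => NE j)) exchange_big (bigD1 t) //=.
rewrite -mulr_sumr fourier_orthonormal eqxx mulr1 big1 ?addr0// => l lt.
by rewrite -mulr_sumr fourier_orthonormal eq_sym (negPf lt) mulr0.
Qed.

Lemma fusion_eigenvalue t :
  eigenvalue (\matrix_(k, m) \sum_i \sum_j N i j k * N i j m)
    (S t ord0 ^- 2).
Proof.
apply/eigenvalueP; exists (row t S); last first.
  apply/eqP => /rowP/(_ ord0); rewrite !mxE => St0.
  by have := fourier_pos fS t; rewrite St0 ltxx.
apply/rowP => m; rewrite !mxE.
under eq_bigr => k _ do rewrite !mxE mulr_sumr.
rewrite exchange_big /=.
(* For fixed [i], the sum over [k] is evaluated by [fusion_mul_row], then the one over [j] by
   [fusion_mul_col]. *)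
transitivity (\sum_i S t i / S t ord0 * ((S t i)^* * S t m / S t ord0)).
  apply: eq_bigr => i _; rewrite -fusion_mul_col mulr_sumr.
  under eq_bigr do rewrite mulr_sumr.
  rewrite exchange_big /=; apply: eq_bigr => j _.
  under eq_bigr do rewrite mulrA.
  by rewrite -mulr_suml fusion_mul_row; ring.
transitivity (S t ord0 ^- 2 * S t m * \sum_i S t i * (S t i)^*).
  by rewrite mulr_sumr; apply: eq_bigr => i _; rewrite -exprVn; ring.
by rewrite fourier_orthonormal eqxx mulr1.
Qed.

Let k j := (S ord0 j / S ord0 ord0) ^+ 2.

(** Row 0 of [S] has norm 1, and its entries are real by symmetry and positivity of column 0. *)
Lemma sum_degrees : \sum_j k j = S ord0 ord0 ^- 2.
Proof.
have S0C l : (S ord0 l)^* = S ord0 l.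
  apply/CrealP/gtr0_real; rewrite -(fourier_sym fS) mxE; exact: fourier_pos.
have := fourier_orthonormal ord0 ord0; rewrite eqxx => S1.
rewrite -[RHS]mul1r -[X in X * _]S1 mulr_suml; apply: eq_bigr => j _.
by rewrite S0C /k exprMn exprVn.
Qed.

Lemma degree_gt0 j : 0 < k j.
Proof.
rewrite exprn_gt0// divr_gt0 ?(fourier_pos fS)//.
by rewrite -(fourier_sym fS) mxE (fourier_pos fS).
Qed.

Lemma degree_dvd_sum t : (forall j, is_int (k j)) -> int_dvd (k t) (\sum_j k j).
Proof.
move=> kZ; have ktE : \sum_j k j = S t ord0 ^- 2 * k t.
  rewrite sum_degrees /k -[in S ord0 t](fourier_sym fS) mxE exprMn exprVn.
  by rewrite mulrA mulVf ?mul1r// expf_neq0// gt_eqF// (fourier_pos fS).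
apply/int_dvdP; split=> //; exists (S t ord0 ^- 2) => //.
have [a ka] := kZ t; have [b sb] : is_int (\sum_j k j) by apply: is_int_sum.
(* The eigenvalue is the quotient of the integers [b] (sum of the degrees) and [a] (the degree
   [k t]), hence rational. *)
have qE : S t ord0 ^- 2 = ratr (b%:~R / a%:~R).
  rewrite fmorph_div /= !ratr_int -ka -sb ktE mulfK// gt_eqF//; exact: degree_gt0.
have /intrP[m qm] : (b%:~R / a%:~R : rat) \is a Num.int.
  have := fusion_eigenvalue t; rewrite qE; apply: is_int_eigenvalue.
  move=> i j; rewrite mxE; apply: is_int_sum => i' _; apply: is_int_sum => j' _.
  by apply: is_intM; apply: (fourier_int fS).
by exists m; rewrite qE qm ratr_int.
Qed.

End Fourier.

Lemma degree_allen (R : realType) (n : nat) (S : 'M[R[i]]_n.+1) j :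
  delta (std_basis (allen_of S) j) = (S ord0 j / S ord0 ord0) ^+ 2.
Proof. by rewrite delta_std_basis mxE. Qed.

Theorem proposition23 (R : realType) (n : nat) (s : 'M[R[i]]_n.+1)
    (hs : allen_matrix s) :
  let k (i : 'I_n.+1) : R[i] := delta (std_basis s i) in
  [/\ k ord0 = 1,
      (forall j : 'I_n.+1,
         k j != 1 ->
         (forall l, k l != 1 -> k j <= k l) ->
         (forall l, k l != 1 -> int_dvd (k j) (k l)) ->
         int_dvd (k j) (#|[set i | k i == 1]|)%:R)
    & (forall (t u : 'I_n.+1) (beta1 : R[i]) (beta2 : nat),
         (forall l, k l < k t -> int_dvd (k l) (k t)) ->
         (forall l, k t < k l -> int_dvd (k t) (k l)) ->
         k u < k t ->
         (forall l, k l < k t -> k l <= k u) ->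
         \sum_(i | k i < k u) k i = beta1 * k u ->
         #|[set i | k i == k u]| = beta2 ->
         int_dvd (k t) (beta1 * k u + beta2%:R * k u)
         /\ (beta1 * k u != 0 -> 1 < k u))].
Proof.
case: hs => S fS -> k.
have kE j : k j = (S ord0 j / S ord0 ord0) ^+ 2 by apply: degree_allen.
have k_gt0 j : 0 < k j by rewrite kE; apply: degree_gt0.
have sum_const c : \sum_(i | k i == c) k i = #|[set i | k i == c]|%:R * c.
  rewrite (eq_bigr (fun=> c)) => [|i /eqP //].
  by rewrite sumr_const mulr_natl; congr (_ *+ _); apply: eq_card => i; rewrite !inE.
have dvd_sum t : (forall j, is_int (k j)) -> int_dvd (k t) (\sum_j k j).
  rewrite (eq_bigr _ (fun j _ => kE j)) kE => kZ; apply: degree_dvd_sum => // j.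
  by rewrite -kE.
have dvd_part t (P : pred 'I_n.+1) : (forall j, is_int (k j)) ->
    (forall i, ~~ P i -> int_dvd (k t) (k i)) -> int_dvd (k t) (\sum_(i | P i) k i).
  (* The sum over [P] is the total minus the sum over the complement, and [k t] divides both. *)
  move=> kZ ktP; rewrite -[\sum_(i | P i) _](addrK (\sum_(i | ~~ P i) k i)).
  apply: int_dvdB; last exact: int_dvd_sum.
  by have := dvd_sum t kZ; rewrite (bigID P).
split=> [|j _ _ kj|t u beta1 beta2 k_lt k_gt kut ku_max sum_beta1 <-].
- by rewrite kE divff ?expr1n// gt_eqF// (fourier_pos fS).
- rewrite -[_%:R]mulr1 -sum_const; apply: dvd_part => // l.
  have [->|/kj/int_dvd_is_int//] := eqVneq (k l) 1.
  by exists 1.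
(* Integrality of every degree is read off the divisibility hypotheses, as [int_dvd] only relates
   integers. *)
have ktZ : is_int (k t) by apply: int_dvd_is_int (k_lt u kut).
have k_ltZ l : k l < k t -> is_int (k l) by move=> /k_lt/int_dvdP[].
have dvd_ge l : ~~ (k l < k t) -> int_dvd (k t) (k l).
  rewrite -real_leNgt ?gtr0_real// le_eqVlt => /predU1P[<-|/k_gt//].
  exact: int_dvd_refl.
split.
  rewrite -sum_beta1 -sum_const.
  (* By maximality of [k u], the degrees below [k t] are those below [k u] and those equal to it. *)
  have -> : \sum_(i | k i < k u) k i + \sum_(i | k i == k u) k i
      = \sum_(i | k i < k t) k i.
    rewrite [RHS](bigID (fun i => k i < k u)) /=; congr (_ + _).
      by apply: eq_bigl => i; rewrite andb_idl// => /lt_trans; apply.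
    apply: eq_bigl => i; apply/eqP/andP => [->|[/ku_max + kiu]].
      by rewrite kut ltxx.
    by rewrite le_eqVlt (negPf kiu) orbF => /eqP.
  apply: dvd_part => // l; have [/k_ltZ//|] := boolP (k l < k t).
  by move=> /dvd_ge/int_dvd_is_int.
rewrite -sum_beta1 => sum_neq0.
(* A nonzero sum has a term [k l < k u]; being a positive integer, [k l] is at least 1. *)
have [l klu|none] := pickP (fun i => k i < k u).
  apply: le_lt_trans (klu); apply: is_int_ge1 => //.
  exact: k_ltZ (lt_trans klu kut).
by rewrite big_pred0 ?eqxx in sum_neq0.
Qed.
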